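(* Let $X$ be an Archimedean pervasive pre-Riesz space. Then every directed band in $X$ is s-closed.
   Context: An ordered vector space is a real vector space $X$ with the partial order given by a cone $X_+$ ($x\le y$ iff $y-x\in X_+$); it is Archimedean if $nx\le y$ for all $n\in\mathbb{N}$ implies $x\le 0$. Put $[a,b]:=\{x\in X: a\le x\le b\}$. A subset $A\subseteq X$ is directed if for all $x,y\in A$ there are $z_1,z_2\in A$ with $z_1\le x,y\le z_2$. A linear subspace $X_0$ of an ordered vector space $Y$ is order dense in $Y$ if $y=\inf\{z\in X_0: y\le z\}$ for every $y\in Y$. $X$ is a pre-Riesz space if there are a vector lattice $Y$ and a bipositive linear map $i:X\to Y$ (i.e. $x\ge0 \Leftrightarrow i(x)\ge 0$) with $i(X)$ order dense in $Y$; then $(Y,i)$ is called a vector lattice cover of $X$. $X$ is pervasive if for some (equivalently, every) vector lattice cover $(Y,i)$ and every $y\in Y_+$, $y\ne0$, there is $x\in X$ with $0<i(x)\le y$. For $M\subseteq X$ let $M^u$ be the set of all upper bounds of $M$ in $X$. Elements $x,y\in X$ are disjoint, $x\perp y$, if $\{x+y,-x-y\}^u=\{x-y,-x+y\}^u$. The disjoint complement of $A\subseteq X$ is $A^{d}:=\{x\in X: x\perp a \text{ for all } a\in A\}$ and $A^{dd}:=(A^d)^d$. A linear subspace $B$ is a band if $B^{dd}=B$. A set $M\subseteq X$ is solid if for all $x\in X$, $y\in M$, $\{x,-x\}^u\supseteq\{y,-y\}^u$ implies $x\in M$; an ideal is a solid linear subspace. Every band in a pre-Riesz space is an ideal. An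 ideal $I$ is s-closed (supremum closed) if for every $z\in X_+$ the relation $z=\sup(I\cap[0,z])$ (meaning that the supremum exists in $X$ and equals $z$) implies $z\in I$. *)

(* Defs.v *)
From HB Require Import structures.
From mathcomp Require Import all_boot all_order all_algebra.
From mathcomp Require Import boolp classical_sets set_interval reals.

Set Implicit Arguments.
Unset Strict Implicit.
Unset Printing Implicit Defensive.

Import Order.TTheory GRing.Theory Num.Theory.
Local Open Scope classical_set_scope.
Local Open Scope ring_scope.

(* The order is the one given by the set of elements [0 <= x]. That set is then
   a cone: its stability under sums and [X_+ `&` - X_+ = [set 0]] follow from
   transitivity and antisymmetry of [<=]. *)
HB.mixin Record POrderedZmodule_isOrderedVect (R : realType) V
    of Num.POrderedZmodule V & GRing.Lmodule R V := {
  subv_ge0 : forall x y : V, (0 <= y - x) = (x <= y);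
  scalev_ge0 : forall (a : R) (x : V),
    0 <= a -> 0 <= x -> 0 <= a *: x
}.

#[short(type="orderedVectType")]
HB.structure Definition OrderedVect (R : realType) :=
  { V of Num.POrderedZmodule V & GRing.Lmodule R V
       & POrderedZmodule_isOrderedVect R V }.

Section OrderedVectDefs.
Variables (R : realType) (X : orderedVectType R).
Implicit Types (x y z : X) (A B : set X).

Definition vector_lattice : Prop :=
  forall x y, supremums [set x; y] !=set0 /\ infimums [set x; y] !=set0.

(* Allowing [n = 0] is harmless: apply the property to [y - x]. *)
Definition archimedean_order : Prop :=
  forall x y, (forall n : nat, x *+ n <= y) -> x <= 0.

Definition directed_set A : Prop :=
  forall x y, A x -> A y -> exists z1 z2,
    [/\ A z1, A z2, z1 <= x /\ z1 <= y & x <= z2 /\ y <= z2].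

Definition order_dense A : Prop :=
  forall y, infimums (A `&` [set z | y <= z]) y.

Definition disjointv x y : Prop :=
  ubound [set x + y; - x - y] = ubound [set x - y; - x + y].

Definition disjoint_compl A : set X :=
  [set x | forall a, A a -> disjointv x a].

Definition band B : Prop :=
  GRing.submod_closed [in B] /\ disjoint_compl (disjoint_compl B) = B.

(* Meant for ideals; bands of pre-Riesz spaces are ideals. *)
Definition s_closed A : Prop :=
  forall z, 0 <= z -> supremums (A `&` `[0, z]) z -> A z.

End OrderedVectDefs.

Arguments vector_lattice {R} X.
Arguments archimedean_order {R} X.

Section VectorLatticeCovers.
Variables (R : realType) (X : orderedVectType R).

Definition bipositive (Y : orderedVectType R) (i : X -> Y) : Prop :=
  forall x, 0 <= x <-> 0 <= i x.

Definition vector_lattice_cover (Y : orderedVectType R)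
    (i : {linear X -> Y}) : Prop :=
  [/\ vector_lattice Y, bipositive i & order_dense (range i)].

Definition pre_Riesz : Prop :=
  exists (Y : orderedVectType R) (i : {linear X -> Y}),
    vector_lattice_cover i.

Definition pervasive : Prop :=
  exists (Y : orderedVectType R) (i : {linear X -> Y}),
    vector_lattice_cover i /\
    forall y : Y, 0 <= y -> y != 0 -> exists x : X, 0 < i x <= y.

End VectorLatticeCovers.

Arguments pre_Riesz {R} X.
Arguments pervasive {R} X.

(* Main.v *)
(** Disjointness in [X] is disjointness of the images in a vector lattice cover
    [i : X -> Y]. If [z = sup (B `&` [0, z])] were not disjoint from some [w] in
    the disjoint complement of [B], pervasiveness would give [x] in [X] with
    [0 < i x <= inf (i z) |i w|]. Each [b] in [B `&` [0, z]] is then disjoint from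
    [x], so [b + x = sup b x <= z]; hence [z - x] bounds [B `&` [0, z]] and
    [z <= z - x], which contradicts [0 < x]. *)
Require Import Defs.
From mathcomp Require Import all_boot all_order all_algebra.
From mathcomp Require Import boolp classical_sets set_interval reals.

Set Implicit Arguments.
Unset Strict Implicit.
Unset Printing Implicit Defensive.

Import Order.TTheory GRing.Theory Num.Theory.
Local Open Scope classical_set_scope.
Local Open Scope ring_scope.

Section OrderedVectTheory.
Variables (R : realType) (V : orderedVectType R).
Implicit Types x y z t u w m n : V.

Lemma lev_add2r z x y : (x + z <= y + z) = (x <= y).
Proof. by rewrite -subv_ge0 opprD addrACA subrr addr0 subv_ge0. Qed.

Lemma lev_subl z x y : (x - z <= y) = (x <= y + z).
Proof. by rewrite -(lev_add2r z (x - z)) subrK. Qed.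

Lemma lev_subr z x y : (x <= y - z) = (x + z <= y).
Proof. by rewrite -(lev_add2r z x) subrK. Qed.

Lemma lev_add x y z t : x <= y -> z <= t -> x + z <= y + t.
Proof.
move=> xy zt; apply: (@le_trans _ _ (y + z)); first by rewrite lev_add2r.
by rewrite ![y + _]addrC lev_add2r.
Qed.

Lemma oppv_le x : 0 <= x -> - x <= x.
Proof. by move=> x0; apply: (le_trans _ x0); rewrite -sub0r lev_subl add0r. Qed.

(** The difference is multiplied by [2^-1]; an ordered group need not have this property. *)
Lemma lev_double x y : x + x <= y + y -> x <= y.
Proof.
rewrite -subv_ge0 opprD addrACA -mulr2n -scaler_nat => xy.
rewrite -subv_ge0 -[y - x]scale1r -(mulVf (_ : 2%:R != 0 :> R)) ?pnatr_eq0 //.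
by rewrite -scalerA scalev_ge0 ?invr_ge0 ?ler0n.
Qed.

Lemma ubound2P x y u : ubound [set x; y] u <-> x <= u /\ y <= u.
Proof.
split=> [ub|[xu yu] _ [->|->]//].
by split; apply: ub; [left|right].
Qed.

Lemma lbound2P x y u : lbound [set x; y] u <-> u <= x /\ u <= y.
Proof.
split=> [lb|[ux uy] _ [->|->]//].
by split; apply: lb; [left|right].
Qed.

Lemma supremum2_le x y m u :
  supremums [set x; y] m -> x <= u -> y <= u -> m <= u.
Proof. by move=> [_ mle] xu yu; apply/mle/ubound2P. Qed.

Lemma disjointvP x y :
  disjointv x y <-> forall u,
    (x + y <= u /\ - x - y <= u) <-> (x - y <= u /\ - x + y <= u).
Proof.
split=> [dxy u|dxy].
  by rewrite -!ubound2P; move: dxy; rewrite /disjointv => ->.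
by apply/seteqP; split=> u /ubound2P/dxy/ubound2P.
Qed.

Lemma disjointvC x y : disjointv x y -> disjointv y x.
Proof.
rewrite /disjointv (addrC x y) (addrC (- x) (- y)) => ->.
by rewrite (addrC x (- y)) (addrC (- x) y) setUC.
Qed.

Lemma disjointvN x y : disjointv x y -> disjointv x (- y).
Proof. by rewrite /disjointv !opprK => ->. Qed.

(* The bound [u >= |z + w| >= |z - m|], with [m = |w|], is turned into
   [u >= z + m] by [inf z m = 0]. *)
Lemma le_addv_of_inf0 z w m u : 0 <= z -> supremums [set w; - w] m ->
  (forall t, t <= z -> t <= m -> t <= 0) ->
  z + w <= u -> - z - w <= u -> z + m <= u.
Proof.
move=> z0 supm inf0 zwu nzwu.
have [/ubound2P[wm nwm] _] := supm.
have wuz : w <= u + z.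
  by rewrite -lev_subl; apply: le_trans zwu; rewrite [z + w]addrC lev_add
    ?oppv_le.
have nwuz : - w <= u + z by rewrite -lev_subl addrC.
have muz : m <= u + z by exact: (supremum2_le supm).
have zum : z <= u + m.
  rewrite -lev_subl; apply: le_trans zwu; rewrite lev_subl -addrA -{1}[z]addr0.
  by rewrite lev_add // addrC -lev_subl sub0r.
(* Halving makes [muz] read [t <= z] and [zum] read [t <= m], while [t <= 0] is the goal. *)
pose t : V := 2^-1 *: (z + m - u).
have tt : t + t = z + m - u.
  by rewrite -mulr2n -scaler_nat scalerA mulfV ?scale1r // pnatr_eq0.
have : t <= 0.
  apply: inf0; apply: lev_double; rewrite tt lev_subl.
    by rewrite -addrA lev_add // addrC.
  by rewrite addrC -addrA lev_add // addrC.
by move=> t0; have := lev_add t0 t0; rewrite tt addr0 lev_subl add0r.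
Qed.

(** The four elements [z + w], [- z - w], [z - w], [- z + w] all lie below [z + m], and
    [le_addv_of_inf0] puts [z + m] below any bound of either pair; the second pair is the first for
    [- w], which has the same modulus [m]. *)
Lemma disjointv_of_inf0 z w m : 0 <= z -> supremums [set w; - w] m ->
  (forall t, t <= z -> t <= m -> t <= 0) -> disjointv z w.
Proof.
move=> z0 supm inf0.
have [/ubound2P[wm nwm] _] := supm.
have nz := oppv_le z0.
have supNm : supremums [set - w; - - w] m by rewrite opprK setUC.
apply/disjointvP => u; split=> -[h1 h2].
  have zmu := le_addv_of_inf0 z0 supm inf0 h1 h2.
  by split; apply: le_trans zmu; apply: lev_add.
rewrite -[X in - z + X <= u]opprK in h2.
have zmu := le_addv_of_inf0 z0 supNm inf0 h1 h2.
by split; apply: le_trans zmu; apply: lev_add.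
Qed.

(* [n] is the negative part of [w]: since [|a + w| <= a + |w| - 2 (inf a n)] and
   [|a - w| = |a + w|], an [s] below [a] and [n] is also below the
   positive part [w + n]. *)
Lemma inf_negpart_le0 a w n s : disjointv a w -> supremums [set - w; 0] n ->
  s <= a -> s <= n -> s <= 0.
Proof.
move=> /disjointvP daw supn sa sn.
have [/ubound2P[nwn n0] _] := supn.
have wn0 : 0 <= w + n by rewrite addrC -lev_subl sub0r.
have ns0 : 0 <= n - s by rewrite subv_ge0.
have as0 : 0 <= a - s by rewrite subv_ge0.
(* This is [a + |w| - 2 s], as [|w|] is [w + n + n]. It bounds [a + w] because [s <= n], and
   [- a - w] because [s <= a] and [0 <= w + n]. *)
pose v := (a + w) + ((n - s) + (n - s)).
have v1 : a + w <= v.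
  by rewrite -{1}[a + w]addr0 lev_add // -[0]addr0 lev_add.
have v2 : - a - w <= v.
  rewrite -opprD -subv_ge0 opprK.
  have -> : v + (a + w) = ((a - s) + (w + n)) + ((a - s) + (w + n)).
    have -> : (a - s) + (w + n) = (a + w) + (n - s).
      by rewrite addrACA [- s + n]addrC.
    by rewrite /v addrAC addrACA.
  by rewrite -[0]addr0 lev_add // -[0]addr0 lev_add.
have [/(_ (conj v1 v2))[v3 _] _] := daw v.
have swn : s <= w + n.
  rewrite -subv_ge0; apply: lev_double; rewrite addr0.
  move: v3; rewrite -subv_ge0.
  have -> // : v - (a - w) = (w + n - s) + (w + n - s).
  rewrite /v opprB addrAC [a + w]addrC [w + a + _]addrACA subrr addr0.
  by rewrite addrACA !addrA.
(* Both [- w] and [0] lie below [n - s], and [n] is their supremum. *)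
have : n <= n - s.
  apply: (supremum2_le supn) => //.
  by rewrite lev_subr addrC lev_subl addrC.
by rewrite lev_subr -{2}[n]add0r addrC lev_add2r.
Qed.

(** The modulus [m] is at most the sum of the positive part [w + n] and the negative part [n]. So
    [inf_negpart_le0] for [- w] first yields [t - n <= 0], and then for [w] yields [t <= 0]. *)
Lemma disjointv_inf0 a w m t : vector_lattice V -> disjointv a w ->
  supremums [set w; - w] m -> t <= a -> t <= m -> t <= 0.
Proof.
move=> latV daw supm ta tm.
have [[n supn] _] := latV (- w) 0.
have [/ubound2P[nwn n0] _] := supn.
have supp : supremums [set - - w; 0] (w + n).
  split=> [|u /ubound2P[]]; rewrite ?opprK.
    apply/ubound2P; split; first by rewrite -{1}[w]addr0 lev_add.
    by rewrite addrC -lev_subl sub0r.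
  move=> wu u0; rewrite addrC -lev_subr; apply: (supremum2_le supn).
    by rewrite -{1}[- w]add0r lev_add.
  by rewrite subv_ge0.
have [/ubound2P[] ] := supp; rewrite opprK => wp p0 _.
have mle : m <= w + n + n.
  apply: (supremum2_le supm); last by rewrite -[- w]add0r lev_add.
  by rewrite -addrA -{1}[w]addr0 lev_add // -[0]addr0 lev_add.
apply: (inf_negpart_le0 daw supn ta).
rewrite -[n]add0r -lev_subl.
apply: (inf_negpart_le0 (disjointvN daw) supp).
  by apply: le_trans ta; rewrite lev_subl -{1}[t]addr0 lev_add.
by rewrite lev_subl (le_trans tm).
Qed.

End OrderedVectTheory.

Section Covers.
Variables (R : realType) (X Y : orderedVectType R) (i : {linear X -> Y}).
Hypothesis coveri : vector_lattice_cover i.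

Lemma cover_le x y : (i x <= i y) = (x <= y).
Proof.
have [_ bip _] := coveri.
by rewrite -subv_ge0 -linearB -[RHS]subv_ge0; apply/idP/idP => /bip.
Qed.

Lemma cover_disjointv x y : disjointv (i x) (i y) <-> disjointv x y.
Proof.
have [_ _ dens] := coveri; rewrite !disjointvP; split=> dxy u.
  by rewrite -!cover_le !(linearD, linearN).
(* By density an upper bound in [Y] is the infimum of upper bounds in [X]. *)
have [_ le_u] := dens u.
split=> -[h1 h2]; split; apply: le_u => _ [[v _ <-] uv];
  have := dxy v; rewrite -!cover_le !(linearD, linearN) => -[l r].
- by have [] := l (conj (le_trans h1 uv) (le_trans h2 uv)).
- by have [] := l (conj (le_trans h1 uv) (le_trans h2 uv)).
- by have [] := r (conj (le_trans h1 uv) (le_trans h2 uv)).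
- by have [] := r (conj (le_trans h1 uv) (le_trans h2 uv)).
Qed.

End Covers.

Theorem corollary12 (R : realType) (X : orderedVectType R)
    (archX : archimedean_order X) (preX : pre_Riesz X) (pervX : pervasive X)
    (B : set X) (dirB : directed_set B) (bandB : band B) :
  s_closed B.
Proof.
move=> z z0 [_ lez]; have [_ <-] := bandB => w Bdw.
have [Y [i [coveri perv]]] := pervX.
have [latY bip _] := coveri.
(* Here [m] is the modulus of [i w], and [y] will be the infimum of [i z] and [m]. *)
have [[m supm] _] := latY (i w) (- i w).
have [_ [y infy]] := latY (i z) m.
have [/lbound2P[yz ym] ley] := infy.
have iz0 : 0 <= i z by apply/bip.
have m0 : 0 <= m.
  have [/ubound2P[wm nwm] _] := supm.
  by apply: lev_double; rewrite addr0 -(subrr (i w)) lev_add.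
have y0 : 0 <= y by apply/ley/lbound2P.
apply/(cover_disjointv coveri); have [y_eq0|y_neq0] := eqVneq y 0.
  apply: (disjointv_of_inf0 iz0 supm) => t tz tm.
  by rewrite -y_eq0; apply/ley/lbound2P.
have [x /andP[x_gt0 xy]] := perv y y0 y_neq0.
have xz : x <= z by rewrite -(cover_le coveri) (le_trans xy).
suff : z <= z - x.
  rewrite lev_subr -{2}[z]add0r addrC lev_add2r -(cover_le coveri) linear0.
  by move=> /(lt_le_trans x_gt0); rewrite ltxx.
apply: lez => b [Bb]; rewrite /= in_itv /= => /andP[_ bz].
have dbw : disjointv (i b) (i w).
  by apply/(cover_disjointv coveri)/disjointvC; exact: Bdw.
(* The element [i b + i x - i z] is below [i b] because [x <= z], and below [m] because [b <= z] and
   [i x <= m]. Disjointness of [i b] and [i w] thus makes it nonpositive. *)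
rewrite lev_subr -(cover_le coveri) linearD -[i z]add0r -lev_subl.
apply: (disjointv_inf0 latY dbw supm); rewrite lev_subl.
  by rewrite lev_add ?(cover_le coveri).
by rewrite addrC lev_add ?(cover_le coveri) // (le_trans xy).
Qed.
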